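(* Let $\alpha$ be a composition of $p$ and $\beta$ a composition of $q$. Then $$X_\alpha\#X_\beta=\sum_{n=\max(p,q)}^{p+q}\ \sum_{M\in\mathcal M^n_{\alpha,\beta}}X_{c(M)},$$ where $c(M)$ is the composition whose parts are the non-zero entries of $M$, read from left to right and from top to bottom.
   Context: Let $\Bbbk$ be a field of characteristic zero and $\Bbbk S_\infty=\bigoplus_{n\ge0}\Bbbk S_n$; permutations are composed as functions. The descent set of $\sigma\in S_n$ is $\mathrm{Des}(\sigma)=\{i\in\{1,\dots,n-1\}:\sigma(i)>\sigma(i+1)\}$. For a composition $\alpha=(a_1,\dots,a_r)$ of $n$ let $J(\alpha)=\{a_1,a_1+a_2,\dots,a_1+\cdots+a_{r-1}\}$ and $X_\alpha=\sum_{\sigma\in S_n,\ \mathrm{Des}(\sigma)\subseteq J(\alpha)}\sigma\in\Bbbk S_n$. For compositions $\alpha=(a_1,\dots,a_r)$ of $p$, $\beta=(b_1,\dots,b_s)$ of $q$ and $\max(p,q)\le n\le p+q$, $\mathcal M^n_{\alpha,\beta}$ is the set of $(s+1)\times(r+1)$ matrices $M=(m_{ij})_{0\le i\le s,\,0\le j\le r}$ with non-negative integer entries such that $m_{00}=0$, the sequence of column sums is $(n-p,a_1,\dots,a_r)$ and the sequence of row sums is $(n-q,b_1,\dots,b_s)$. Heisenberg product of permutations: for a finite-dimensional vector space $V$, let $\Psi_V(\sigma)$, $\sigma\in S_n$, be the endomorphism of the tensor Hopf algebra $T(V)$ (concatenation product, elements of $V$ primitive) given by $v_1\cdots v_n\mapsto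 v_{\sigma(1)}\cdots v_{\sigma(n)}$ on $V^{\otimes n}$ and $0$ on other degrees. On $\mathrm{End}(T(V))$ put $(f\#g)(h)=\sum f(h_1)_2\,g(h_2f(h_1)_1)$ (Sweedler notation). The Heisenberg product $\#$ on $\Bbbk S_\infty$ is the bilinear product with $\Psi_V(u\#v)=\Psi_V(u)\#\Psi_V(v)$ for all finite-dimensional $V$. Explicitly, for $\sigma\in S_p$, $\tau\in S_q$, $$\sigma\#\tau=\sum_{n=\max(p,q)}^{p+q}\ \sum_{\substack{\xi\in\mathrm{Sh}(p,n-p)\\ \eta\in\mathrm{Sh}(p+q-n,n-q)}}\xi\bigl((\sigma\eta)\times\mathrm{Id}_{n-p}\bigr)\beta_{2n-p-q,p+q-n}(\mathrm{Id}_{n-q}\times\tau),$$ where $\mathrm{Sh}(p,q)$ is the set of $\xi\in S_{p+q}$ increasing on $\{1,\dots,p\}$ and on $\{p+1,\dots,p+q\}$, $\sigma\times\tau$ is the standard parabolic product ($\sigma$ on the first block, shifted $\tau$ on the last), and $\beta_{p,q}(i)=q+i$ for $i\le p$, $\beta_{p,q}(p+i)=i$ for $i\le q$. *)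

(* Defs.v *)
From HB Require Import structures.
From mathcomp Require Import all_boot all_algebra all_fingroup.
From mathcomp Require Import finmap monalg.
From mathcomp Require Import zify.

Set Implicit Arguments.
Unset Strict Implicit.
Unset Printing Implicit Defensive.

Import GRing.Theory.

Local Open Scope ring_scope.

(* Positions and values of permutations are 0-based throughout: i in
   {1, ..., n} is represented by i - 1 : 'I_n. *)

(** * Linear extension to free modules *)

Section LinearExtension.
Context (k : fieldType) (K : choiceType) (V : lmodType k).

Definition linext (f : K -> V) (u : {malg k[K]}) : V :=
  \sum_(x <- msupp u) u@_x *: f x.

Lemma linextEw f (u : {malg k[K]}) (A : {fset K}) :
  fsubset (msupp u) A -> linext f u = \sum_(x <- A) u@_x *: f x.
Proof.
move=> sA; apply: big_fset_incl => // x _ /mcoeff_outdom ->.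
by rewrite scale0r.
Qed.

Fact linext_is_linear f : linear (linext f).
Proof.
move=> a u v; pose A := fsetU (msupp u) (msupp v).
have sD : fsubset (msupp (a *: u + v)) A.
  by rewrite (fsubset_trans (msuppD_le _ _)) // fsetSU // msuppZ_le.
rewrite (linextEw _ sD) (@linextEw f u A) ?fsubsetUl //.
rewrite (@linextEw f v A) ?fsubsetUr // scaler_sumr -big_split /=.
by apply: eq_bigr => x _; rewrite mcoeffD mcoeffZ scalerDl scalerA.
Qed.

HB.instance Definition _ f :=
  GRing.isLinear.Build k {malg k[K]} V _ (linext f) (linext_is_linear f).

Lemma linextU f x : linext f << x >> = f x.
Proof.
rewrite /linext msuppU oner_eq0 big_seq_fset1 mcoeffUU.
exact: scale1r.
Qed.

End LinearExtension.

(** * The module of all permutations *)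

Definition perms : Type := {n : nat & 'S_n}.
HB.instance Definition _ := Choice.on perms.

Notation kSinf k := {malg k[perms]}.

Definition inS n (s : 'S_n) : perms := Tagged (fun m => 'S_m) s.

(* Composition of functions; the group law of 'S_n is in diagrammatic order. *)
Definition pcomp n (s t : 'S_n) : 'S_n := (t * s)%g.
Infix "\po" := pcomp (at level 40, left associativity).

Lemma pcompE n (s t : 'S_n) i : (s \po t) i = s (t i).
Proof. by rewrite /pcomp permM. Qed.

(** * The basis X *)

Definition is_composition (n : nat) (a : seq nat) : bool :=
  all (fun x => 0 < x)%N a && (sumn a == n).

(* 1 <= i <= n - 1 is a descent when s(i) > s(i+1); here the entries compared
   are those with 0-based indices i.-1 and i. *)
Definition Des n (s : 'S_n) : {set 'I_n} :=
  [set i : 'I_n | [exists j : 'I_n, (j.+1 == i)%N && (s i < s j)%N]].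

Definition J (a : seq nat) : seq nat :=
  [seq sumn (take i a) | i <- iota 1 (size a).-1].

Definition X (k : fieldType) (a : seq nat) : kSinf k :=
  \sum_(s : 'S_(sumn a) | [forall i in Des s, (i : nat) \in J a]) << inS s >>.

(** * The Heisenberg product *)

(* The (a, n - a)-shuffles in S_n. *)
Definition shuffle (a n : nat) : {set 'S_n} :=
  [set x : 'S_n | [forall i : 'I_n, forall j : 'I_n,
     [&& (i < j)%N & (j < a) || (a <= i)]%N ==> (x i < x j)%N]].

Definition par_fun m n (s : 'S_m) (t : 'S_n) (i : 'I_(m + n)) : 'I_(m + n) :=
  match split i with inl j => lshift n (s j) | inr j => rshift m (t j) end.

Fact par_fun_inj m n (s : 'S_m) (t : 'S_n) : injective (par_fun s t).
Proof.
move=> i1 i2; rewrite /par_fun -{2}(splitK i1) -{2}(splitK i2).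
case: (split i1) (split i2) => j1 [] j2 /eqP /=;
  rewrite ?eq_lrshift ?eq_rlshift // ?eq_lshift ?eq_rshift //.
  by move=> /eqP/perm_inj ->.
by move=> /eqP/perm_inj ->.
Qed.

Definition par m n (s : 'S_m) (t : 'S_n) : 'S_(m + n) := perm (@par_fun_inj m n s t).

Definition blockswap_fun p q (i : 'I_(p + q)) : 'I_(p + q) :=
  cast_ord (addnC q p)
    (match split i with inl j => rshift q j | inr j => lshift p j end).

Fact blockswap_fun_inj p q : injective (@blockswap_fun p q).
Proof.
move=> i1 i2; rewrite /blockswap_fun => /cast_ord_inj.
rewrite -{2}(splitK i1) -{2}(splitK i2).
case: (split i1) (split i2) => j1 [] j2 /eqP /=;
  by rewrite ?eq_lrshift ?eq_rlshift // ?eq_lshift ?eq_rshift // => /eqP ->.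
Qed.

(* i |-> q + i for i < p, and p + i |-> i for i < q. *)
Definition blockswap p q : 'S_(p + q) := perm (@blockswap_fun_inj p q).

(* Transport along an equality m = n; only used when this equality holds. *)
Definition recast n m (s : 'S_m) : 'S_n :=
  if @eqP _ m n is ReflectT e then cast_perm e s else 1%g.

Section Heisenberg.
Context (k : fieldType).

Definition heis_term n p q (s : 'S_p) (t : 'S_q) : kSinf k :=
  \sum_(x in shuffle p n) \sum_(e in shuffle (p + q - n) p)
    << inS (x \po recast n (par (s \po e) (1%g : 'S_(n - p)))
              \po recast n (blockswap (2 * n - p - q) (p + q - n))
              \po recast n (par (1%g : 'S_(n - q)) t)) >>.

Definition heis_perm (u v : perms) : kSinf k :=
  let p := tag u in let q := tag v in
  \sum_(maxn p q <= n < (p + q).+1) heis_term n (tagged u) (tagged v).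

(* heis_Psi and heis_unique below show that heis is the only product that Psi
   maps to the Heisenberg product of endomorphisms of tensor algebras. *)
Definition heis (u v : kSinf k) : kSinf k :=
  linext (fun x => linext (fun y => heis_perm x y) v) u.

End Heisenberg.

(** * The matrices indexing the product *)

(* Row and column 0 are the extra ones. All entries sum up to n, so bounding
   them by n loses nothing. *)
Definition matrices (n : nat) (a b : seq nat) :
    {set 'M['I_n.+1]_((size b).+1, (size a).+1)} :=
  [set M : 'M['I_n.+1]_((size b).+1, (size a).+1) | [&& M ord0 ord0 == 0%N :> nat,
     [forall j, \sum_i (M i j : nat) == nth 0 (n - sumn a :: a) j]%N &
     [forall i, \sum_j (M i j : nat) == nth 0 (n - sumn b :: b) i]%N]].

Definition reading n r c (M : 'M['I_n.+1]_(r, c)) : seq nat :=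
  [seq x <- [seq (M i j : nat) | i <- enum 'I_r, j <- enum 'I_c] | x != 0]%N.

(** * Characterization of the Heisenberg product on tensor algebras *)

Section PermWord.
Context (A : Type).
Implicit Types (v w : seq A).

(* v_1 ... v_n |-> v_s(1) ... v_s(n), for w of size n. *)
Definition permw n (s : 'S_n) w : seq A :=
  pmap (fun i : 'I_n => onth w (s i)) (enum 'I_n).

Lemma permw_Some n (s : 'S_n) w : size w = n ->
  map Some (permw s w) = [seq onth w (s i) | i <- enum 'I_n].
Proof.
move=> sw; rewrite /permw; elim: (enum 'I_n) => //= i r IH.
have : onth w (s i) by rewrite onthTE sw.
by case: (onth w (s i)) => //= x _; rewrite IH.
Qed.

Lemma size_permw n (s : 'S_n) w : size w = n -> size (permw s w) = n.
Proof.
by move=> sw; rewrite -(size_map Some) permw_Some // size_map size_enum_ord.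
Qed.

Lemma onth_permw n (s : 'S_n) w (i : 'I_n) : size w = n ->
  onth (permw s w) i = onth w (s i).
Proof.
move=> sw; rewrite onthE permw_Some // (nth_map i) ?size_enum_ord //.
by rewrite nth_ord_enum.
Qed.

Lemma permw_eq n (s : 'S_n) w v : size w = n -> size v = n ->
  (forall i : 'I_n, onth w (s i) = onth v i) -> permw s w = v.
Proof.
move=> sw sv E; apply: eq_from_onth_le => i.
rewrite size_permw // sv maxnn => lin.
by rewrite (@onth_permw _ _ _ (Ordinal lin)).
Qed.

Lemma permwM n (s t : 'S_n) w : size w = n ->
  permw (s \po t) w = permw t (permw s w).
Proof.
move=> sw; apply: permw_eq; rewrite ?size_permw // => i.
by rewrite !onth_permw ?size_permw // pcompE.
Qed.

Lemma permw1 n w : size w = n -> permw (1%g : 'S_n) w = w.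
Proof. by move=> sw; apply: permw_eq => // i; rewrite perm1. Qed.

Lemma permw_par m n (s : 'S_m) (t : 'S_n) v w : size v = m -> size w = n ->
  permw (par s t) (v ++ w) = permw s v ++ permw t w.
Proof.
move=> sv sw; apply: permw_eq; rewrite ?size_cat ?size_permw ?sv ?sw // => i.
rewrite permE /par_fun !onth_cat sv size_permw //.
case: (splitP i) => j ->; first by rewrite /= ltn_ord onth_permw.
by rewrite /= !ltnNge !leq_addr /= !addKn onth_permw.
Qed.

Lemma permw_blockswap p q v w : size v = q -> size w = p ->
  permw (blockswap p q) (v ++ w) = w ++ v.
Proof.
move=> sv sw; apply: permw_eq; rewrite ?size_cat ?sv ?sw // 1?addnC // => i.
rewrite permE /blockswap_fun !onth_cat sv sw /=.
case: (splitP i) => j -> /=; first by rewrite ltnNge leq_addr addKn.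
by rewrite ltn_ord addKn.
Qed.

Lemma permw_recast n m (s : 'S_m) w : m = n -> permw (recast n s) w = permw s w.
Proof.
move=> e; subst n; rewrite /recast; case: eqP => // e.
by rewrite cast_perm_id.
Qed.

End PermWord.

Section Shuffles.
Variables (n : nat).
Implicit Types (m : n.-tuple bool) (x : 'S_n).

Definition unshuffle m : seq 'I_n :=
  [seq i <- enum 'I_n | tnth m i] ++ [seq i <- enum 'I_n | ~~ tnth m i].

Lemma uniq_unshuffle m : uniq (unshuffle m).
Proof.
rewrite cat_uniq; apply/and3P; split; rewrite ?(filter_uniq _ (enum_uniq _)) //.
by apply/hasPn => i; rewrite !mem_filter => /andP[/negbTE-> _].
Qed.

Lemma size_unshuffle m : size (unshuffle m) = n.
Proof.
rewrite size_cat !size_filter -[RHS](size_enum_ord n).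
by rewrite -(count_predC (fun i => tnth m i)).
Qed.

Fact shuffle_of_inj m : injective (fun i : 'I_n => nth i (unshuffle m) i).
Proof.
move=> i j /eqP; rewrite (set_nth_default i j) ?size_unshuffle //.
by rewrite nth_uniq ?size_unshuffle ?uniq_unshuffle // => /eqP/val_inj.
Qed.

Definition shuffle_of m : 'S_n := perm (@shuffle_of_inj m).

Lemma shuffle_ofE m : map (shuffle_of m) (enum 'I_n) = unshuffle m.
Proof.
apply/(@eq_from_onth_le _ _ _) => i; rewrite size_map size_enum_ord size_unshuffle.
rewrite maxnn => lin; pose j := Ordinal lin; rewrite -[i]/(val j).
rewrite onth_map onthE (nth_map j) ?size_enum_ord // nth_ord_enum /= permE.
by rewrite onthE (nth_map j) ?size_unshuffle.
Qed.

Definition mask_of p x : n.-tuple bool :=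
  mktuple (fun i : 'I_n => (x^-1%g i < p)%N).

Lemma filter_mask_tuple A m (w : seq A) : size w = n ->
  [seq onth w i | i : 'I_n <- [seq i <- enum 'I_n | tnth m i]]
    = map Some (mask m w).
Proof.
move=> sw; rewrite filter_mask map_tnth_enum !map_mask; congr mask.
apply: (@eq_from_nth _ None) => [|i]; rewrite size_map size_enum_ord ?size_map //.
move=> lin; rewrite (nth_map (Ordinal lin)) ?size_enum_ord //.
by rewrite nth_enum_ord // onthE.
Qed.

Lemma tnth_mapC m i : tnth [tuple of map negb m] i = ~~ tnth m i.
Proof. by rewrite tnth_map. Qed.

Lemma permw_shuffle_of A m (w : seq A) : size w = n ->
  permw (shuffle_of m) w = mask m w ++ mask (map negb m) w.
Proof.
move=> sw; apply: (inj_map Some_inj); rewrite permw_Some //.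
rewrite (map_comp (fun i : 'I_n => onth w i)) shuffle_ofE !map_cat.
rewrite filter_mask_tuple //; congr (_ ++ _).
rewrite -(filter_mask_tuple [tuple of map negb m]) //.
by congr map; apply: eq_filter => i; rewrite tnth_mapC.
Qed.

Lemma shuffle_of_le m : shuffle_of m \in shuffle (count id m) n.
Proof.
have cm : size [seq i <- enum 'I_n | tnth m i] = count id m.
  by rewrite -[in RHS](map_tnth_enum m) count_map size_filter.
rewrite inE; apply/forallP => i; apply/forallP => j.
apply/implyP => /andP[ij h]; rewrite !permE.
have tr : transitive (fun i j : 'I_n => i < j)%N.
  by move=> ? ? ?; apply: ltn_trans.
have so (P : pred 'I_n) : sorted (fun i j : 'I_n => i < j)%N (filter P (enum 'I_n)).
  apply: sorted_filter => //; rewrite -(sorted_map (f := val) (e' := ltn)) val_enum_ord.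
  exact: iota_ltn_sorted.
have sz := size_unshuffle m.
rewrite (set_nth_default i j) ?sz // /unshuffle !nth_cat cm.
have [jlt|jge] := ltnP j (count id m).
  rewrite (ltn_trans ij jlt).
  by apply: (sorted_ltn_nth tr); rewrite ?inE ?cm // (ltn_trans ij).
move: h; rewrite ltnNge jge /= => ige; rewrite [(i < count id m)%N]ltnNge ige /=.
have szd : size [seq i <- enum 'I_n | ~~ tnth m i] = (n - count id m)%N.
  by rewrite -[X in (X - _)%N]sz size_cat cm addKn.
by apply: (sorted_ltn_nth tr); rewrite ?inE ?szd // ?ltn_sub2r // (leq_ltn_trans ige).
Qed.

Lemma count_mask_of p x : (p <= n)%N -> count id (mask_of p x) = p.
Proof.
move=> lpn; rewrite -(map_tnth_enum (mask_of p x)) count_map.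
rewrite (eq_count (a2 := fun i => (x^-1%g i < p)%N)); last first.
  by move=> i /=; rewrite tnth_mktuple.
have pe : perm_eq [seq x^-1%g i | i <- enum 'I_n] (enum 'I_n).
  apply: uniq_perm; rewrite ?(map_inj_uniq perm_inj) ?enum_uniq // => i.
  rewrite mem_enum; apply/mapP; exists (x i); rewrite ?mem_enum //.
  by rewrite permK.
have := seq.permP pe (fun i : 'I_n => (i < p)%N); rewrite count_map => ->.
rewrite -(count_map val (fun i => i < p)%N) val_enum_ord -size_filter.
by rewrite -[X in iota _ X](subnKC lpn) iotaD filter_cat size_cat !size_filter
  (eq_in_count (a2 := predT)) ?count_predT ?size_iota
  ?(eq_in_count (a2 := pred0) (s := iota (0 + p) _)) ?count_pred0 ?addn0 // => i;
  rewrite mem_iota ?add0n // => /andP[? ?]; rewrite /= ltnNge; apply/negbTE/negPn.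
Qed.

Lemma shuffle_mask_of p x : (p <= n)%N -> x \in shuffle p n ->
  shuffle_of (mask_of p x) = x.
Proof.
move=> lpn; rewrite inE => /forallP xsh.
have tr : transitive (fun i j : 'I_n => i < j)%N.
  by move=> ? ? ?; apply: ltn_trans.
have so : sorted (fun i j : 'I_n => i < j)%N (enum 'I_n).
  by rewrite -(sorted_map (f := val) (e' := ltn)) val_enum_ord iota_ltn_sorted.
have irr : irreflexive (fun i j : 'I_n => i < j)%N by move=> i; rewrite ltnn.
have main (b : bool) :
    [seq i <- enum 'I_n | (x^-1%g i < p)%N == b] =
    map x [seq i : 'I_n <- enum 'I_n | (i < p)%N == b].
  apply: (irr_sorted_eq tr irr); first exact: (sorted_filter tr).
    rewrite sorted_map.
    apply: (@sub_in_sorted _ [pred i : 'I_n | (i < p)%N == b]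
      (fun i j => (i < j)%N)).
    - move=> i j /eqP ib /eqP jb ij; have /forallP/(_ j)/implyP := xsh i.
      by apply; rewrite ij jb leqNgt ib; case: (b).
    - by rewrite filter_all.
    - exact: (sorted_filter tr).
  move=> i; rewrite -[in RHS](permKV x i) (mem_map perm_inj).
  by rewrite !(mem_enum, mem_filter) ?permKV.
apply/permP => i.
have: map (shuffle_of (mask_of p x)) (enum 'I_n) = map x (enum 'I_n).
  rewrite shuffle_ofE /unshuffle.
  have -> : map x (enum 'I_n) = map x ([seq i : 'I_n <- enum 'I_n | (i < p)%N == true]
      ++ [seq i : 'I_n <- enum 'I_n | (i < p)%N == false]).
    congr map; apply: (inj_map val_inj); rewrite map_cat.
    rewrite -!(filter_map val (fun i => (i < p)%N == _)) val_enum_ord.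
    rewrite -{1 2 3}(subnKC lpn) iotaD !filter_cat.
    have E1 b : [seq i <- iota 0 p | (i < p)%N == b] = if b then iota 0 p else [::].
      case: b; first apply/all_filterP/allP.
        by move=> j; rewrite mem_iota /= => ->.
      rewrite -(filter_pred0 (iota 0 p)); apply: eq_in_filter => j.
      by rewrite mem_iota /= => ->.
    have E2 b : [seq i <- iota (0 + p) (n - p) | (i < p)%N == b]
        = if b then [::] else iota (0 + p) (n - p).
      case: b; last apply/all_filterP/allP.
        rewrite -(filter_pred0 (iota (0 + p) (n - p))); apply: eq_in_filter => j.
        by rewrite mem_iota add0n => /andP[pj _]; rewrite ltnNge pj.
      by move=> j; rewrite mem_iota add0n => /andP[pj _]; rewrite ltnNge pj.
    by rewrite !E1 !E2 cats0.
  rewrite map_cat -!main; congr (_ ++ _); apply: eq_filter => j;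
  by rewrite tnth_mktuple ?eqb_id ?eqbF_neg.
move/(congr1 (fun r => nth i r i)).
have E (f : 'I_n -> 'I_n) : nth i [seq f j | j <- enum 'I_n] i = f i.
  by rewrite (@nth_map _ i _ i f i (enum 'I_n)) ?nth_ord_enum // size_enum_ord.
by rewrite (E (shuffle_of _)) (E x).
Qed.

Lemma mask_shuffle_of m : mask_of (count id m) (shuffle_of m) = m.
Proof.
apply: eq_from_tnth => i; rewrite tnth_mktuple.
set x := shuffle_of m; rewrite -{2}(permKV x i); move: (x^-1%g i) => {i} i.
rewrite permE /unshuffle.
have cm : size [seq i <- enum 'I_n | tnth m i] = count id m.
  by rewrite -[in RHS](map_tnth_enum m) count_map size_filter.
rewrite nth_cat cm; case: ifP => h.
  have : nth i [seq i <- enum 'I_n | tnth m i] i \in [seq i <- enum 'I_n | tnth m i].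
    by rewrite mem_nth ?cm.
  by rewrite mem_filter => /andP[-> _].
set r := [seq i <- enum 'I_n | ~~ tnth m i].
have : nth i r (i - count id m) \in r.
  have ci : (count id m <= i)%N by rewrite leqNgt h.
  apply: mem_nth; rewrite -(ltn_add2l (count id m)) subnKC //.
  by rewrite -[X in (X + _)%N]cm -size_cat size_unshuffle.
by rewrite mem_filter => /andP[/negbTE-> _].
Qed.

Lemma sum_shuffle (V : nmodType) p (F : 'S_n -> V) : (p <= n)%N ->
  \sum_(x in shuffle p n) F x =
  \sum_(m : n.-tuple bool | count id m == p) F (shuffle_of m).
Proof.
move=> lpn; rewrite (reindex_onto shuffle_of (mask_of p)); last first.
  by move=> x; apply: shuffle_mask_of.
apply: eq_bigl => m; apply/andP/eqP => [[_ /eqP <-]|<-].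
  exact: count_mask_of.
by rewrite shuffle_of_le mask_shuffle_of.
Qed.

End Shuffles.

Lemma count_negb n (m : n.-tuple bool) :
  count id (map negb m) = (n - count id m)%N.
Proof.
have := count_predC id m; rewrite size_tuple count_map => E.
by rewrite -[LHS]/(count (predC id) m); lia.
Qed.

Section TensorAlgebra.
Context (k : fieldType) (d : nat).

(* The words in d letters are a basis of T(V) for V of dimension d. *)
Definition word : Type := seq 'I_d.
HB.instance Definition _ := Choice.on word.

Notation T := {malg k[word]}.

Definition conc (u v : T) : T :=
  linext (fun x : word => linext (fun y : word => << (x ++ y : word) >>) v) u.

(* The coproduct for which letters are primitive: a word goes to the sum of
   (subword) (x) (complementary subword) over all sets of positions. *)
Definition comul : T -> {malg k[(word * word)%type]} :=
  linext (fun w : word => \sum_(m : (size w).-tuple bool)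
    << ((mask m w, mask (map negb m) w) : (word * word)%type) >>).

(* (f # g)(h) = sum f(h_1)_2 . g(h_2 . f(h_1)_1) in Sweedler notation. *)
Definition heis_End (f g : T -> T) (h : T) : T :=
  linext (fun h12 : (word * word)%type =>
    linext (fun f12 : (word * word)%type =>
      conc << f12.2 >> (g (conc << h12.2 >> << f12.1 >>)))
    (comul (f << h12.1 >>)))
  (comul h).

Definition act (x : perms) (w : word) : T :=
  if size w == tag x then << (permw (tagged x) w : word) >> else 0.

Definition Psi (u : kSinf k) : T -> T :=
  linext (fun w => linext (fun x => act x w) u).

Lemma Psi_word u (w : word) : Psi u << w >> = linext (fun x => act x w) u.
Proof. by rewrite /Psi linextU. Qed.

Lemma concUU (x y : word) : conc << x >> << y >> = << (x ++ y : word) >>.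
Proof. by rewrite /conc !linextU. Qed.

Lemma conc0 u : conc u 0 = 0.
Proof. rewrite /conc {1}/linext big1 // => x _. by rewrite linear0 scaler0. Qed.

Lemma linext_sumr (K : choiceType) (V : lmodType k) I (r : seq I) (P : pred I)
    (F : I -> K -> V) (u : {malg k[K]}) :
  linext (fun x => \sum_(i <- r | P i) F i x) u = \sum_(i <- r | P i) linext (F i) u.
Proof.
rewrite /linext exchange_big /=; apply: eq_bigr => x _.
by rewrite scaler_sumr.
Qed.

Lemma linextZr (K : choiceType) (V : lmodType k) c
    (F : K -> V) (u : {malg k[K]}) :
  linext (fun x => c *: F x) u = c *: linext F u.
Proof.
by rewrite /linext scaler_sumr; apply: eq_bigr => x _; rewrite !scalerA mulrC.
Qed.

Lemma eq_linext (K : choiceType) (V : lmodType k) (F G : K -> V) (u : {malg k[K]}) :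
  F =1 G -> linext F u = linext G u.
Proof. by move=> E; apply: eq_bigr => x _; rewrite E. Qed.

Lemma linext_linext (K L : choiceType) (V : lmodType k)
    (F : L -> V) (G : K -> {malg k[L]}) (u : {malg k[K]}) :
  linext F (linext G u) = linext (fun x => linext F (G x)) u.
Proof.
rewrite [linext G u]/linext linear_sum /=.
by apply: eq_bigr => x _; rewrite linearZ.
Qed.

Lemma linextC (K L : choiceType) (V : lmodType k)
    (F : K -> L -> V) (u : {malg k[K]}) (v : {malg k[L]}) :
  linext (fun x => linext (F x) v) u = linext (fun y => linext (F^~ y) u) v.
Proof.
rewrite {1}/linext /(linext _ v); under eq_bigr do rewrite scaler_sumr.
rewrite exchange_big; apply: eq_bigr => y _; rewrite scaler_sumr.
by apply: eq_bigr => x _; rewrite !scalerA mulrC.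
Qed.

Lemma conc_linextr (K : choiceType) (F : K -> T) (v : {malg k[K]}) (u : T) :
  conc u (linext F v) = linext (fun x => conc u (F x)) v.
Proof.
rewrite {1}/conc linextC linext_linext; apply: eq_linext => x.
by rewrite /conc [in RHS]linextC.
Qed.

Lemma comulU n (u : word) : size u = n ->
  comul << u >> = \sum_(m : n.-tuple bool)
    << ((mask m u, mask (map negb m) u) : (word * word)%type) >>.
Proof. by move=> <-; rewrite /comul linextU. Qed.


Lemma heis_Psi_basis (x y : perms) (w : word) :
  Psi (heis_perm k x y) << w >> = heis_End (Psi << x >>) (Psi << y >>) << w >>.
Proof.
case: x y => p s [q t]; rewrite Psi_word /heis_perm /= /heis_End.
rewrite /comul linextU !linear_sum /=.
set n := size w.
pose R := \sum_(m : n.-tuple bool | count id m == p)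
  \sum_(m' : p.-tuple bool | count id m' == (p + q - n)%N)
   (if (maxn p q <= n < (p + q).+1)%N then
     let x := mask m w in let y := mask (map negb m) w in
     let u := permw s x in
     << (mask (map negb m') u ++ permw t (y ++ mask m' u) : word) >> else 0 : T).
transitivity R.
  transitivity (\sum_(maxn p q <= i < (p + q).+1 | i == n)
     linext (fun x => act x w) (heis_term k n s t)).
    rewrite [RHS]big_mkcond; apply: eq_bigr => i _.
    case: eqP => [-> //|/eqP/negbTE ni].
    rewrite /heis_term !linear_sum big1 // => xi _; rewrite linear_sum /= big1 // => e _.
    by rewrite /= linextU /act /= eq_sym ni.
  rewrite -big_filter (_ : filter _ _ = if (maxn p q <= n < (p + q).+1)%N then [:: n] else [::]); last first.
    case: ifP => rg.
      have un : uniq (index_iota (maxn p q) (p + q).+1) by apply: iota_uniq.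
      by rewrite (filter_pred1_uniq un) // mem_index_iota.
    apply/eqP; rewrite -[_ == _]negbK -has_filter.
    by apply/hasPn => i; rewrite mem_index_iota; apply: contraTneq => ->; rewrite rg.
  rewrite /R; case: ifP => [rg|_]; last first.
    by rewrite big_nil big1 // => m _; rewrite big1.
  have [/andP[pn qn] npq] : (p <= n)%N && (q <= n)%N /\ (n <= p + q)%N.
    by move: rg; rewrite geq_max ltnS => /andP[].
  rewrite big_seq1 /heis_term linear_sum /= sum_shuffle //.
  apply: eq_bigr => m /eqP cm; rewrite linear_sum /= sum_shuffle; last first.
    by lia.
  apply: eq_bigr => m' /eqP cm'; rewrite linextU /act /= eqxx.
  congr << _ >>.
  have sx : size (mask m w) = p by rewrite size_mask ?size_tuple.
  have sy : size (mask (map negb m) w) = (n - p)%N.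
    by rewrite size_mask ?size_map ?size_tuple // count_negb cm.
  rewrite !permwM ?size_permw // permw_shuffle_of //.
  rewrite [permw (recast n (par (pcomp _ _) _)) _]permw_recast ?subnKC //.
  rewrite permw_par // permw1 // permwM // permw_shuffle_of ?size_permw //.
  set u := permw s _; set y := mask (map negb m) w.
  have su : size u = p by rewrite size_permw.
  have sa : size (mask m' u) = (p + q - n)%N by rewrite size_mask ?size_tuple.
  have sb : size (mask (map negb m') u) = (n - q)%N.
    by rewrite size_mask ?size_map ?size_tuple // count_negb cm'; lia.
  have e1 : (2 * n - p - q + (p + q - n) = n)%N by lia.
  rewrite -catA [permw (recast n (blockswap _ _)) _]permw_recast // permw_blockswap //; last first.
    by rewrite size_cat sb sy; lia.
  rewrite -catA permw_recast ?subnK // permw_par ?permw1 //.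
  by rewrite size_cat sy sa; lia.
rewrite /R big_mkcond; apply: eq_bigr => m _ /=; rewrite linextU /= Psi_word linextU.
rewrite /act /= size_mask ?size_tuple //.
have cmn : (count id m <= n)%N by rewrite -[X in (_ <= X)%N](size_tuple m) count_size.
have sy : size (mask (map negb m) w) = (n - count id m)%N.
  by rewrite size_mask ?size_map ?size_tuple // count_negb.
case: eqP => cm; last by rewrite !linear0.
have su : size (permw s (mask m w)) = p.
  by rewrite size_permw // size_mask ?size_tuple.
rewrite -/comul (comulU su) linear_sum /= [LHS]big_mkcond; apply: eq_bigr => m' _.
rewrite linextU /= concUU Psi_word linextU /act /=.
have cmp : (count id m' <= p)%N by rewrite -[X in (_ <= X)%N](size_tuple m') count_size.
rewrite size_cat sy cm size_mask ?size_tuple ?su //.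
rewrite cm in cmn; move: (count id m') cmp => c cmp.
have arith N : (p <= N)%N ->
    (N - p + c == q)%N = (c == p + q - N)%N && (maxn p q <= N < (p + q).+1)%N.
  by clear -cmp; move=> ?; lia.
rewrite (arith _ cmn).
by case: eqP => _ //=; [case: ifP|]; rewrite ?concUU ?conc0.
Qed.

Lemma comul_linext (K : choiceType) (F : K -> T) (u : {malg k[K]}) :
  comul (linext F u) = linext (fun x => comul (F x)) u.
Proof. by rewrite /comul linext_linext. Qed.

Lemma heis_End_Psi u v (w : word) :
  heis_End (Psi u) (Psi v) << w >> =
  linext (fun x => linext (fun y =>
    heis_End (Psi << x >>) (Psi << y >>) << w >>) v) u.
Proof.
have E z (b : word) : Psi z << b >> = linext (fun x => Psi << x >> << b >>) z.
  by rewrite Psi_word; apply: eq_linext => x; rewrite Psi_word linextU.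
pose G g (h12 f12 : word * word) := conc << f12.2 >> (g (conc << h12.2 >> << f12.1 >>)).
have EG h12 z : linext (G (Psi v) h12) z = linext (fun y => linext (G (Psi << y >>) h12) z) v.
  rewrite linextC; apply: eq_linext => f12.
  by rewrite /G concUU E conc_linextr.
have D f g : heis_End f g << w >> = \sum_(m : (size w).-tuple bool)
    linext (G g (mask m w, mask (map negb m) w)) (comul (f << (mask m w : word) >>)).
  rewrite /heis_End {2}/comul linextU linear_sum /=.
  by apply: eq_bigr => m _; rewrite linextU.
rewrite D; under [RHS]eq_linext => x.
  under eq_linext => y do rewrite D.
  rewrite linext_sumr; over.
rewrite linext_sumr; apply: eq_bigr => m _.
rewrite (E u (mask m w : word)).
rewrite comul_linext; apply: etrans (linext_linext _ _ _) _.
by apply: eq_linext => x; apply: EG.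
Qed.

Lemma heis_Psi (u v : kSinf k) (h : T) :
  Psi (heis u v) h = heis_End (Psi u) (Psi v) h.
Proof.
transitivity (linext (fun w : word => heis_End (Psi u) (Psi v) << w >>) h); last first.
  rewrite /heis_End {3}/comul linext_linext; apply: eq_linext => w.
  by rewrite /comul linextU.
apply: eq_linext => w; rewrite heis_End_Psi /heis linext_linext.
apply: eq_linext => x; rewrite linext_linext; apply: eq_linext => y.
by rewrite -heis_Psi_basis Psi_word.
Qed.

End TensorAlgebra.

Lemma Psi_inj (k : fieldType) (u v : kSinf k) :
  (forall d (h : {malg k[word d]}), Psi u h = Psi v h) -> u = v.
Proof.
move=> E; apply/malgP => -[n s].
pose w : word n := enum 'I_n.
have sw : size w = n by rewrite size_enum_ord.
have W (t : 'S_n) : permw t w = map t (enum 'I_n).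
  apply: (inj_map Some_inj); rewrite permw_Some // -[RHS]map_comp.
  apply: eq_map => i /=; rewrite onthE (nth_map i) ?sw //.
  by rewrite nth_ord_enum.
have C (z : kSinf k) : (Psi z << w >>)@_(map s (enum 'I_n) : word n) = z@_(inS s).
  rewrite Psi_word /linext raddf_sum /=.
  have Eact x : (act k x w)@_(map s (enum 'I_n) : word n) = (x == inS s)%:R.
    case: x => m t; rewrite /act /= sw; case: eqP => [e|ne]; last first.
      by rewrite mcoeff0; case: eqP => // -[]/esym/ne.
    subst m; rewrite mcoeffU W; congr (nat_of_bool _)%:R.
    apply/eqP/eqP => [/eq_in_map et|/eqP].
      by congr Tagged; apply/permP => i; apply: et; rewrite mem_enum.
    by rewrite -tag_eqE /tag_eq /= tagged_asE eqxx => /eqP ->.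
  under eq_bigr do rewrite mcoeffZ Eact.
  case: (msuppP z (inS s)) => zs; last first.
    apply: big1_fset => x xz _; case: eqP => [e|]; last by rewrite mulr0.
    by rewrite e (negbTE zs) in xz.
  rewrite (big_fsetD1 (inS s)) //= eqxx mulr1 big1_fset ?addr0 // => x.
  by rewrite in_fsetD1 => /andP[/negbTE -> _]; rewrite mulr0.
by rewrite -!C E.
Qed.

Lemma heis_unique (k : fieldType) (op : kSinf k -> kSinf k -> kSinf k) :
  (forall d u v (h : {malg k[word d]}),
     Psi (op u v) h = heis_End (Psi u) (Psi v) h) ->
  forall u v, op u v = heis u v.
Proof. by move=> E u v; apply: Psi_inj => d h; rewrite E heis_Psi. Qed.

(* Main.v *)
(* Everything is compared on the tensor algebras, where Psi is jointly faithful.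
   There X_(a_1, ..., a_r) is the convolution product of the projections on degrees
   a_1, ..., a_r: it sends a word to the sum of the concatenations of its cuttings
   into r successive subwords of lengths a_1, ..., a_r. Since the coproduct is
   multiplicative, coassociative and cocommutative, splitting such a concatenation
   amounts to writing a = a' + a'' and cutting the two halves of the word according
   to a' and a''. Applied once to Delta(f(h_1)), this peels off row 0 of the matrix
   (with m_00 = 0, as h_2 only meets f(h_1)_1); the remaining composition
   X_b o X_(n - p, a'') is then expanded row by row in the same way. *)

Require Import Defs.
From mathcomp Require Import all_boot all_algebra all_fingroup.
From mathcomp Require Import finmap monalg zify.

Set Implicit Arguments.
Unset Strict Implicit.
Unset Printing Implicit Defensive.

Import GRing.Theory.

Local Open Scope ring_scope.

(** * The unshuffling coproduct on words *)

Section Splittings.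
Context (A : Type).
Implicit Types (u v w : seq A).

(** The terms of the coproduct of [w], with multiplicity, by recursion on the first letter;
    [sum_splits_masks] links them to the masks in [comul]. *)
Fixpoint splits w : seq (seq A * seq A) :=
  if w is x :: w' then
    [seq (x :: p.1, p.2) | p <- splits w'] ++ [seq (p.1, x :: p.2) | p <- splits w']
  else [:: ([::], [::])].

Context (V : nmodType).

Lemma sum_splits_nil (G : seq A * seq A -> V) :
  \sum_(p <- splits [::]) G p = G ([::], [::]).
Proof. by rewrite big_seq1. Qed.

Lemma sum_splits_cons (G : seq A * seq A -> V) x w :
  \sum_(p <- splits (x :: w)) G p =
  \sum_(p <- splits w) G (x :: p.1, p.2) + \sum_(p <- splits w) G (p.1, x :: p.2).
Proof. by rewrite big_cat !big_map. Qed.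

(** Multiplicativity of the coproduct: letters choose their halves independently. *)
Lemma sum_splits_cat (G : seq A * seq A -> V) u v :
  \sum_(p <- splits (u ++ v)) G p =
  \sum_(p <- splits u) \sum_(q <- splits v) G (p.1 ++ q.1, p.2 ++ q.2).
Proof.
elim: u G => [|x u IH] G.
  by rewrite sum_splits_nil; apply: eq_bigr => -[].
by rewrite cat_cons !sum_splits_cons !IH.
Qed.

Lemma sum_splits_comm (G : seq A -> seq A -> V) w :
  \sum_(p <- splits w) G p.1 p.2 = \sum_(p <- splits w) G p.2 p.1.
Proof.
elim: w G => [|x w IH] G; first by rewrite !sum_splits_nil.
rewrite !sum_splits_cons addrC /=.
by rewrite (IH (fun u v => G u (x :: v))) (IH (fun u v => G (x :: u) v)).
Qed.

(** Coassociativity: on both sides each letter goes to one of three ordered subwords. *)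
Lemma sum_splits_assoc (G : seq A -> seq A -> seq A -> V) w :
  \sum_(p <- splits w) \sum_(q <- splits p.1) G q.1 q.2 p.2 =
  \sum_(p <- splits w) \sum_(q <- splits p.2) G p.1 q.1 q.2.
Proof.
elim: w G => [|x w IH] G; first by rewrite !sum_splits_nil.
rewrite !sum_splits_cons.
under eq_bigr do rewrite sum_splits_cons.
under [X in _ = _ + X]eq_bigr do rewrite sum_splits_cons.
rewrite !big_split /= (IH (fun t u v => G (x :: t) u v)).
rewrite (IH (fun t u v => G t (x :: u) v)) (IH (fun t u v => G t u (x :: v))).
by rewrite addrA.
Qed.

(** Both sides distribute the letters over four subwords; only the two middle ones trade places. *)
Lemma sum_splits_interchange (G : seq A -> seq A -> seq A -> seq A -> V) w :
  \sum_(p <- splits w) \sum_(q <- splits p.1) \sum_(r <- splits p.2)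
    G q.1 q.2 r.1 r.2 =
  \sum_(p <- splits w) \sum_(q <- splits p.1) \sum_(r <- splits p.2)
    G q.1 r.1 q.2 r.2.
Proof.
elim: w G => [|x w IH] G; first by rewrite !sum_splits_nil.
(* One sum per destination of the first letter; [H] is general so that [E] also serves with the
   middle arguments exchanged. *)
have E (H : seq A -> seq A -> seq A -> seq A -> V) :
    \sum_(p <- splits (x :: w)) \sum_(q <- splits p.1) \sum_(r <- splits p.2)
      H q.1 q.2 r.1 r.2 =
    (\sum_(p <- splits w) \sum_(q <- splits p.1) \sum_(r <- splits p.2)
      H (x :: q.1) q.2 r.1 r.2 +
    \sum_(p <- splits w) \sum_(q <- splits p.1) \sum_(r <- splits p.2)
      H q.1 (x :: q.2) r.1 r.2) +
    (\sum_(p <- splits w) \sum_(q <- splits p.1) \sum_(r <- splits p.2)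
      H q.1 q.2 (x :: r.1) r.2 +
    \sum_(p <- splits w) \sum_(q <- splits p.1) \sum_(r <- splits p.2)
      H q.1 q.2 r.1 (x :: r.2)).
  rewrite sum_splits_cons; congr (_ + _); rewrite -big_split; apply: eq_bigr => p _.
    by rewrite sum_splits_cons.
  by rewrite -big_split; apply: eq_bigr => q _; rewrite sum_splits_cons.
rewrite E (E (fun s t u v => G s u t v)).
rewrite (IH (fun s t u v => G (x :: s) t u v)) (IH (fun s t u v => G s (x :: t) u v)).
rewrite (IH (fun s t u v => G s t (x :: u) v)) (IH (fun s t u v => G s t u (x :: v))).
exact: addrACA.
Qed.

Lemma sum_splits_masks (G : seq A * seq A -> V) w :
  \sum_(p <- splits w) G p =
  \sum_(m : (size w).-tuple bool) G (mask m w, mask (map negb m) w).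
Proof.
elim: w G => [|x w IH] G.
  rewrite sum_splits_nil (big_pred1 [tuple]) // => m.
  by apply/esym/eqP/tuple0.
rewrite sum_splits_cons !IH /=.
pose h (bm : bool * (size w).-tuple bool) := [tuple of bm.1 :: bm.2].
rewrite [RHS](reindex h) /=; last first.
  exists (fun m : (size w).+1.-tuple bool => (thead m, [tuple of behead m])) => [[c m] _|m _].
    by congr pair; apply: val_inj.
  by rewrite [RHS]tuple_eta; apply: val_inj.
rewrite -(pair_bigA _ (fun c m => G (mask (h (c, m)) (x :: w),
  mask (map negb (h (c, m))) (x :: w)))) /=.
by rewrite big_bool.
Qed.

End Splittings.

(** * Cutting words into blocks of prescribed lengths *)

Section SplitsSize.
Context (A : eqType).
Implicit Types (u v w : seq A).

Lemma size_splits w p : p \in splits w -> (size p.1 + size p.2 = size w)%N.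
Proof.
elim: w p => [|x w IH] p /=; first by rewrite inE => /eqP ->.
rewrite mem_cat => /orP[] /mapP[q /IH /= <- ->] /=; lia.
Qed.

(* The words obtained by cutting [w] into successive subwords of lengths [a] and
   concatenating them: [X a] maps [w] to the sum of these. *)
Fixpoint unshuffles (a : seq nat) w : seq (seq A) :=
  if a is x :: a' then
    flatten [seq [seq p.1 ++ v | v <- unshuffles a' p.2] | p <- splits w & size p.1 == x]
  else if w is [::] then [:: [::]] else [::].

Lemma size_unshuffles a w v : v \in unshuffles a w -> size w = sumn a /\ size v = sumn a.
Proof.
elim: a w v => [|x a IH] w v /=; first by case: w => //; rewrite inE => /eqP ->.
case/flatten_mapP => p; rewrite mem_filter => /andP[/eqP <- /size_splits <-].
by case/mapP => t /IH[-> <-] ->; rewrite size_cat.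
Qed.

Lemma unshuffles_neq a w : size w != sumn a -> unshuffles a w = [::].
Proof.
case E: (unshuffles a w) => [//|v s].
have /size_unshuffles[-> _] : v \in unshuffles a w by rewrite E mem_head.
by rewrite eqxx.
Qed.

Context (V : nmodType).
Implicit Types (F : seq A -> V).

Lemma sum_unshuffles_cons F x a w :
  \sum_(v <- unshuffles (x :: a) w) F v =
  \sum_(p <- splits w | size p.1 == x) \sum_(v <- unshuffles a p.2) F (p.1 ++ v).
Proof.
rewrite /= big_flatten big_map big_filter; apply: eq_bigr => p _.
by rewrite big_map.
Qed.

(** A part 0 forces an empty first subword, and exactly one splitting of [w] has one. *)
Lemma sum_unshuffles_cons0 F a w :
  \sum_(v <- unshuffles (0%N :: a) w) F v = \sum_(v <- unshuffles a w) F v.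
Proof.
rewrite sum_unshuffles_cons.
transitivity (\sum_(p <- splits w | nilp p.1) \sum_(v <- unshuffles a p.2) F v).
  by apply: eq_bigr => -[u v] /= /nilP ->.
pose G u := \sum_(v <- unshuffles a u) F v.
rewrite -[RHS]/(G w) big_mkcond.
under eq_bigr do rewrite -/(G _).
elim: w (G) => [|x w IH] {}G; first by rewrite sum_splits_nil.
by rewrite sum_splits_cons /= big1 // add0r -[RHS](IH (fun u => G (x :: u))).
Qed.

(** This is what lets [reading] discard the zero entries of a matrix. *)
Lemma sum_unshuffles_filter F a w :
  \sum_(v <- unshuffles [seq x <- a | x != 0%N] w) F v =
  \sum_(v <- unshuffles a w) F v.
Proof.
elim: a F w => [//|x a IH] F w.
case: (eqVneq x 0%N) => [->|nx]; first by rewrite sum_unshuffles_cons0 IH.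
rewrite [filter _ _]/= nx !sum_unshuffles_cons; apply: eq_bigr => p _.
by rewrite IH.
Qed.

(** Concatenation of compositions is convolution of the cuttings, by coassociativity. *)
Lemma sum_unshuffles_cat F a b w :
  \sum_(v <- unshuffles (a ++ b) w) F v =
  \sum_(p <- splits w) \sum_(u <- unshuffles a p.1) \sum_(v <- unshuffles b p.2) F (u ++ v).
Proof.
elim: a F w => [|x a IH] F w.
  rewrite -[LHS](sum_unshuffles_cons0 F) sum_unshuffles_cons big_mkcond.
  apply: eq_bigr => -[[|y u] v] _ /=; last by rewrite big_nil.
  by rewrite big_seq1.
rewrite sum_unshuffles_cons [LHS]big_mkcond.
under [RHS]eq_bigr do rewrite sum_unshuffles_cons big_mkcond.
rewrite (sum_splits_assoc (fun s t u => if size s == x then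
  \sum_(v <- unshuffles a t) \sum_(v' <- unshuffles b u) F ((s ++ v) ++ v') else 0)).
apply: eq_bigr => p _; case: ifP => _; last by rewrite big1.
rewrite IH; apply: eq_bigr => q _; apply: eq_bigr => u _.
by apply: eq_bigr => v _; rewrite catA.
Qed.

End SplitsSize.

(** * Expansion of composed cuttings over matrices *)

(** The multidegrees of a coproduct: [r.1] and [r.2] count the letters that each block sends to
    either half. The subtraction is exact, as [i] is at most [x]. *)
Fixpoint vec_splits (c : seq nat) : seq (seq nat * seq nat) :=
  if c is x :: c' then
    [seq (i :: r.1, (x - i)%N :: r.2) | i <- iota 0 x.+1, r <- vec_splits c']
  else [:: ([::], [::])].

Lemma sum_vec_splits_cons (V : nmodType) (G : seq nat * seq nat -> V) x c :
  \sum_(r <- vec_splits (x :: c)) G r =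
  \sum_(i < x.+1) \sum_(r <- vec_splits c) G (val i :: r.1, (x - i)%N :: r.2).
Proof.
rewrite -(big_mkord predT (fun i => \sum_(r <- vec_splits c) G (i :: r.1, (x - i)%N :: r.2))).
rewrite /index_iota subn0; exact: big_allpairs_dep.
Qed.

Lemma vec_splits_sumn c r : r \in vec_splits c -> (sumn r.1 + sumn r.2 = sumn c)%N.
Proof.
elim: c r => [|x c IH] r; first by rewrite inE => /eqP ->.
by move=> /allpairsPdep[i [q [+ /IH/= <- ->]]] /=; rewrite mem_iota => /andP[_ h]; lia.
Qed.

(* Compatibility of the coproduct with concatenation, iterated. *)
Lemma sum_unshuffles_splits (A : eqType) (V : nmodType)
    (G : seq A -> seq A -> V) c w :
  \sum_(u <- unshuffles c w) \sum_(p <- splits u) G p.1 p.2 =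
  \sum_(r <- vec_splits c) \sum_(p <- splits w)
    \sum_(u <- unshuffles r.1 p.1) \sum_(v <- unshuffles r.2 p.2) G u v.
Proof.
elim: c G w => [|x c IH] G w.
  rewrite big_seq1 /=; case: w => [|y w].
    by rewrite sum_splits_nil /= !big_seq1.
  rewrite big_nil sum_splits_cons !big1 ?addr0 // => p _; rewrite ?big_nil //.
  by rewrite big1 // => u _; rewrite big_nil.
rewrite sum_unshuffles_cons sum_vec_splits_cons big_mkcond.
(* [s] and [t] are the halves of the first block, [u] and [v] those of the remaining letters. *)
pose H s t u v := if (size s + size t == x)%N then
  \sum_(r <- vec_splits c) \sum_(u1 <- unshuffles r.1 u) \sum_(u2 <- unshuffles r.2 v)
     G (s ++ u1) (t ++ u2) else 0.
transitivity (\sum_(p <- splits w) \sum_(q <- splits p.1) \sum_(r <- splits p.2)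
    H q.1 q.2 r.1 r.2).
  apply: eq_bigr => p _.
  case: eqP => E; last first.
    rewrite big_seq big1 // => q /size_splits qE; rewrite big1 // => r _.
    by rewrite /H qE; case: eqP.
  under eq_bigr do rewrite sum_splits_cat.
  rewrite exchange_big [LHS]big_seq [RHS]big_seq; apply: eq_bigr => q /size_splits qE.
  rewrite (IH (fun u v => G (q.1 ++ u) (q.2 ++ v))) exchange_big.
  by apply: eq_bigr => r _; rewrite /H qE E eqxx.
(* The interchange law turns cutting then splitting into splitting then cutting. *)
rewrite sum_splits_interchange [RHS](eq_bigr _ (fun i _ => exchange_big _ _ _ _ _ _)).
rewrite [RHS]exchange_big; apply: eq_bigr => p _ /=.
under [RHS]eq_bigr do under eq_bigr do
  rewrite sum_unshuffles_cons big_mkcond.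
under [RHS]eq_bigr do rewrite exchange_big.
rewrite [RHS]exchange_big; apply: eq_bigr => q _ /=.
(* Only [i = size q.1] contributes, and no index does when [q.1] is longer than [x]. *)
transitivity (\sum_(i < x.+1 | size q.1 == i) \sum_(s <- splits p.2 | size s.1 == (x - i)%N)
   H q.1 s.1 q.2 s.2).
  have [lx|gx] := leqP (size q.1) x.
    rewrite (big_pred1 (Ordinal (lx : (size q.1 < x.+1)%N))) /=; last first.
      by move=> i; apply/eqP/eqP => [E|->//]; apply: val_inj.
    rewrite [RHS]big_mkcond; apply: eq_bigr => s _.
    by case: eqP => // ns; rewrite /H ifN //; apply/eqP => E; apply: ns; lia.
  rewrite [RHS]big1 => [|i /eqP iE]; last by have := ltn_ord i; lia.
  by rewrite big1 // => s _; rewrite /H ifN //; apply/eqP; lia.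
rewrite big_mkcond; apply: eq_bigr => i _.
case: eqP => E; last by rewrite big1.
transitivity (\sum_(j <- vec_splits c) \sum_(u <- unshuffles j.1 q.2)
  \sum_(s <- splits p.2 | size s.1 == (x - i)%N) \sum_(v <- unshuffles j.2 s.2)
     G (q.1 ++ u) (s.1 ++ v)); last first.
  by apply: eq_bigr => r _; apply: eq_bigr => u _; rewrite sum_unshuffles_cons.
under [RHS]eq_bigr do rewrite exchange_big.
rewrite [RHS]exchange_big; apply: eq_bigr => s /eqP Es.
by rewrite /H ifT //; apply/eqP; have := ltn_ord i; lia.
Qed.

(* The matrices, as lists of rows, with row sums [b] and column sums [c]. *)
Fixpoint row_splits (b c : seq nat) : seq (seq (seq nat)) :=
  if b is y :: b' then
    flatten [seq [seq r.1 :: M | M <- row_splits b' r.2] | r <- vec_splits c & sumn r.1 == y]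
  else if sumn c == 0%N then [:: [::]] else [::].

Lemma sum_row_splits_cons (V : nmodType) (F : seq (seq nat) -> V) y b c :
  \sum_(M <- row_splits (y :: b) c) F M =
  \sum_(r <- vec_splits c | sumn r.1 == y) \sum_(M <- row_splits b r.2) F (r.1 :: M).
Proof.
rewrite /= big_flatten big_map big_filter; apply: eq_bigr => r _.
by rewrite big_map.
Qed.

Lemma row_splits_sumn b c M : M \in row_splits b c ->
  sumn (flatten M) = sumn b /\ sumn b = sumn c.
Proof.
elim: b c M => [|y b IH] c M /=; first by case: eqP => // ->; rewrite inE => /eqP ->.
case/flatten_mapP => r; rewrite mem_filter => /andP[/eqP <- /vec_splits_sumn <-].
by case/mapP => N /IH[E1 E2] ->; rewrite /= sumn_cat E1 -E2.
Qed.

Section Composition.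
Context (A : eqType) (V : nmodType).
Implicit Types (F : seq A -> V).

(** Solomon's product rule for the descent algebra, on words. Taking the first block of [b] splits a
    word already cut along [c], which chooses the first row [r.1]; the other rows come from
    induction on the second half, with column sums [r.2]. *)
Lemma sum_unshuffles_comp F b c (w : seq A) :
  \sum_(u <- unshuffles c w) \sum_(v <- unshuffles b u) F v =
  \sum_(M <- row_splits b c) \sum_(v <- unshuffles (flatten M) w) F v.
Proof.
elim: b F c w => [|y b IH] F c w.
  rewrite /=; case: eqP => c0; last first.
    rewrite big_nil big_seq big1 // => u /size_unshuffles[_].
    by case: u => [/esym/c0|x u _] //; rewrite big_nil.
  (* [c] sums to 0 here, so deleting its zero parts leaves the empty composition. *)
  rewrite big_seq1 -(sum_unshuffles_filter _ c).
  have -> : [seq x <- c | x != 0%N] = [::].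
    by elim: c c0 => //= -[|x] c IHc //=.
  by case: w => [|x w]; rewrite /= ?big_nil // !big_seq1.
under eq_bigr do rewrite sum_unshuffles_cons big_mkcond.
rewrite (sum_unshuffles_splits (fun s t => if size s == y then
  \sum_(v <- unshuffles b t) F (s ++ v) else 0)).
rewrite sum_row_splits_cons [RHS]big_mkcond; apply: eq_bigr => r _.
transitivity (\sum_(p <- splits w) \sum_(u <- unshuffles r.1 p.1)
   if sumn r.1 == y then \sum_(u2 <- unshuffles r.2 p.2) \sum_(v <- unshuffles b u2) F (u ++ v)
   else 0).
  apply: eq_bigr => p _; rewrite [LHS]big_seq [RHS]big_seq.
  apply: eq_bigr => u /size_unshuffles[_ ->]; case: eqP => // _.
  by rewrite big1.
case: eqP => _; last by rewrite big1 // => p _; rewrite big1.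
under [RHS]eq_bigr do rewrite sum_unshuffles_cat.
rewrite [RHS]exchange_big; apply: eq_bigr => p _ /=.
rewrite [RHS]exchange_big; apply: eq_bigr => u _.
exact: (IH (fun v => F (u ++ v))).
Qed.

(* The extra column, of sum [size w - sumn a], accounts for the letters that the
   first operand does not see. *)
Lemma sum_unshuffles_heis F a b (w : seq A) :
  \sum_(p <- splits w) \sum_(u <- unshuffles a p.1) \sum_(q <- splits u)
     \sum_(v <- unshuffles b (p.2 ++ q.1)) F (q.2 ++ v) =
  \sum_(r <- vec_splits a) \sum_(M <- row_splits b ((size w - sumn a)%N :: r.2))
     \sum_(v <- unshuffles (r.1 ++ flatten M) w) F v.
Proof.
(* [s], [t], [u] stand for f(h_1)_2, f(h_1)_1 and h_2; cocommutativity lets f(h_1)_2 be the half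
   with degrees [r.1], the future row 0. *)
pose H (s t u : seq A) := \sum_(v <- unshuffles b (u ++ t)) F (s ++ v).
transitivity (\sum_(p <- splits w) \sum_(r <- vec_splits a) \sum_(t <- splits p.1)
    \sum_(u <- unshuffles r.1 t.1) \sum_(v <- unshuffles r.2 t.2) H u v p.2).
  apply: eq_bigr => p _; rewrite -(sum_unshuffles_splits (fun u v => H u v p.2)).
  by apply: eq_bigr => u _; rewrite (sum_splits_comm (fun s t => H t s p.2)).
rewrite exchange_big [LHS]big_seq [RHS]big_seq; apply: eq_bigr => r /vec_splits_sumn Er /=.
rewrite (sum_splits_assoc (fun s t z => \sum_(u <- unshuffles r.1 s)
   \sum_(v <- unshuffles r.2 t) H u v z)).
under [RHS]eq_bigr do rewrite sum_unshuffles_cat.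
rewrite [RHS]exchange_big [LHS]big_seq [RHS]big_seq; apply: eq_bigr => p /size_splits Ep /=.
rewrite exchange_big [RHS]exchange_big [LHS]big_seq [RHS]big_seq.
apply: eq_bigr => u /size_unshuffles[Eu _].
(* h_2 is the first block of a cutting along [size w - sumn a] followed by [r.2]. *)
rewrite -(sum_unshuffles_comp (fun v => F (u ++ v))) sum_unshuffles_cons.
rewrite (sum_splits_comm (fun s t => \sum_(v <- unshuffles r.2 s) H u v t)).
rewrite [RHS]big_mkcond [LHS]big_seq [RHS]big_seq; apply: eq_bigr => t /size_splits Et.
(* If [t.2] can be cut along [r.2], adding lengths gives the required length of [t.1]; otherwise
   both sums are empty. *)
have [E|/unshuffles_neq ->] := eqVneq (size t.2) (sumn r.2).
  by rewrite ifT //; apply/eqP; rewrite -Ep Eu -Et E -Er addnCA addnK.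
by rewrite !big_nil if_same.
Qed.

(** A corner 0 put in front of [r.1] completes the matrix; counting letters forces row 0 to sum to
    [n - q]. *)
Lemma sum_unshuffles_heis_mx F a b (w : seq A) :
  let n := size w in let p := sumn a in let q := sumn b in
  \sum_(p <- splits w) \sum_(u <- unshuffles a p.1) \sum_(q <- splits u)
     \sum_(v <- unshuffles b (p.2 ++ q.1)) F (q.2 ++ v) =
  if (maxn p q <= n < (p + q).+1)%N then
    \sum_(M <- row_splits ((n - q)%N :: b) ((n - p)%N :: a) | head 0%N (flatten M) == 0%N)
     \sum_(v <- unshuffles (flatten M) w) F v
  else 0.
Proof.
move=> n p q; rewrite sum_unshuffles_heis -/n -/p.
case: ifP => rg; last first.
  (* A surviving term would have [n = sumn r1 + q] and [q = (n - p) + sumn r2], which puts [n] in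
     the range. *)
  rewrite big_seq big1 // => -[r1 r2] /vec_splits_sumn /= Er.
  rewrite big_seq big1 // => M /row_splits_sumn /= [EM Eb].
  rewrite unshuffles_neq ?big_nil // sumn_cat -/n.
  apply: contraFneq rg; rewrite -/p -/q in Er EM Eb *. lia.
rewrite [RHS]big_mkcond sum_row_splits_cons [RHS]big_mkcond sum_vec_splits_cons.
(* Nonzero corner entries violate the condition on the head; only the index 0 remains. *)
rewrite [RHS]big_ord_recl [X in _ = _ + X]big1 ?addr0 => [|i _]; last first.
  rewrite big1 // => r _; case: ifP => // _.
  by rewrite big1.
rewrite [LHS]big_seq [RHS]big_seq; apply: eq_bigr => -[r1 r2] /vec_splits_sumn /= Er.
rewrite subn0; case: eqP => [_|Ne].
  by apply: eq_bigr => M _; rewrite sum_unshuffles_cons0.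
(* Equality of row and column totals would give [r1] the sum [n - q], so there is no such [M]. *)
rewrite big_seq big1 // => M /row_splits_sumn /= [EM Eb].
by case: Ne; rewrite -/p -/q in Er EM Eb *; lia.
Qed.

End Composition.

(** * Descent classes and shuffles *)

(** Partial sums after the first are shifted by [x]. The bound matters for empty [a]: [J] omits the
    total sum. *)
Lemma mem_J_cons x a i : (i < x + sumn a)%N ->
  (i \in J (x :: a)) = (i == x) || (x < i)%N && (i - x \in J a)%N.
Proof.
case: a => [|y a]; first by rewrite addn0 /J /= in_nil ltnNge => lix; lia.
move=> _; rewrite /J /= -[2%N]/(1 + 1)%N iotaDl -map_comp inE /= addn0.
case: eqVneq => //= nx; apply/mapP/andP => [[j jm /= e]|[lt /mapP[j jm e]]].
  split; first by lia.
  by rewrite e addKn; apply/mapP; exists j.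
by exists j; rewrite //= -e subnKC // ltnW.
Qed.

Lemma Des_subJP n a (s : 'S_n) :
  reflect (forall i j : 'I_n, i.+1 = j -> (j : nat) \notin J a -> (s i < s j)%N)
    [forall i in Des s, (i : nat) \in J a].
Proof.
apply: (iffP forall_inP) => [H i j ij|H j].
  rewrite ltn_neqAle => nJ; rewrite -[X in X && _]negbK; apply: contraNT nJ => nlt.
  apply: H; rewrite inE; apply/existsP; exists i; rewrite ij eqxx /=.
  move: nlt; rewrite negb_and !negbK -ltnNge => /orP[/eqP/val_inj/perm_inj e|//].
  by have := ij; rewrite e; lia.
rewrite inE => /existsP[i /andP[/eqP ij lt]].
by apply: contraTT lt => /(H _ _ ij); rewrite -leqNgt => /ltnW.
Qed.

Lemma shuffleP a n (x : 'S_n) :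
  reflect (forall i j : 'I_n, (i < j)%N -> (j < a)%N || (a <= i)%N -> (x i < x j)%N)
    (x \in shuffle a n).
Proof.
rewrite inE; apply: (iffP forallP) => [H i j ij jx|H i].
  by have /forallP/(_ j)/implyP := H i; apply; rewrite ij.
by apply/forallP => j; apply/implyP => /andP[]; apply: H.
Qed.

(** By strong induction the points before [i] are fixed, so [t i < i] is impossible; if [t i > i],
    the preimage of [i] lies after [i] and below [p], against monotonicity. *)
Lemma perm_increasing_id n p (t : 'S_n) :
  (forall i, (t i < p)%N = (i < p)%N) ->
  (forall i j : 'I_n, (i < j)%N -> (j < p)%N -> (t i < t j)%N) ->
  forall i : 'I_n, (i < p)%N -> t i = i.
Proof.
move=> tp tinc i; have [k] := ubnP (val i); elim: k i => // k IH i lik ip.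
have fixlt (j : 'I_n) : (j < i)%N -> t j = j.
  by move=> ji; apply: IH; [apply: leq_trans ji _|apply: ltn_trans ji ip].
case: (ltngtP (t i) i) => [/[dup] lt /fixlt/perm_inj|gt|/val_inj //].
  by move=> E; rewrite E ltnn in lt.
have jp : ((t^-1)%g i < p)%N by rewrite -tp permKV.
case: (ltngtP ((t^-1)%g i) i) => [lt|/tinc/(_ jp)|/val_inj].
- by have := fixlt _ lt; rewrite permKV => E; rewrite -E ltnn in lt.
- by rewrite permKV => /(ltn_trans gt); rewrite ltnn.
- by move/(congr1 t); rewrite permKV => <-.
Qed.

Lemma par_lshift m n (s : 'S_m) (t : 'S_n) i : par s t (lshift n i) = lshift n (s i).
Proof. by rewrite permE /par_fun (unsplitK (inl i)). Qed.

Lemma par_rshift m n (s : 'S_m) (t : 'S_n) i : par s t (rshift m i) = rshift m (t i).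
Proof. by rewrite permE /par_fun (unsplitK (inr i)). Qed.

Lemma par_fixed m n (t : 'S_(m + n)) :
  (forall i : 'I_m, t (lshift n i) = lshift n i) -> exists s : 'S_n, t = par 1%g s.
Proof.
(* The default [j] is never taken: by injectivity [t] maps the last block to itself. *)
move=> tl; pose f j := if split (t (rshift m j)) is inr j' then j' else j.
have fE j : rshift m (f j) = t (rshift m j).
  rewrite /f; case: splitP => i E; last exact: val_inj.
  have /perm_inj/eqP : t (rshift m j) = t (lshift n i) by rewrite tl; apply: val_inj.
  by rewrite eq_rlshift.
have fI : injective f.
  by move=> i j /(congr1 (@rshift m n)); rewrite !fE => /perm_inj/rshift_inj.
exists (perm fI); apply/permP => i; rewrite -(splitK i).
by case: (split i) => j /=; rewrite ?par_lshift ?par_rshift ?perm1 // permE fE.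
Qed.

Lemma par_inj m n : injective (fun s : 'S_n => par (1%g : 'S_m) s).
Proof.
move=> s t E; apply/permP => i; apply: (@rshift_inj m).
by rewrite -!(@par_rshift m n 1%g) E.
Qed.

Lemma par_ltl m n (s : 'S_m) (t : 'S_n) i : (par s t i < m)%N = (i < m)%N.
Proof.
by rewrite -(splitK i); case: (split i) => j /=;
  rewrite ?par_lshift ?par_rshift /= ?ltn_ord // !ltnNge !leq_addr.
Qed.

Section Step.
Variables (x : nat) (a : seq nat).
Let n := sumn a.
Implicit Types (m : (x + n).-tuple bool).

(** Coset factorization: [m] selects the values taken, in increasing order, at the first [x]
    positions, and [s] arranges the others. *)
Definition join_perm (m : (x + n).-tuple bool) (s : 'S_n) : 'S_(x + n) :=
  shuffle_of m \po par (1%g : 'S_x) s.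

Lemma mask_of_join m s : count id m = x -> mask_of x (join_perm m s) = m.
Proof.
move=> cm; rewrite -{2}(mask_shuffle_of m) cm; apply: eq_from_tnth => i.
rewrite !tnth_mktuple -(par_ltl 1%g s); congr (val _ < _)%N.
by apply: (@perm_inj _ (shuffle_of m)); rewrite -pcompE -/(join_perm m s) !permKV.
Qed.

Lemma join_permI m s t : join_perm m s = join_perm m t -> s = t.
Proof. by move/mulIg/par_inj. Qed.

(** The shuffle is increasing on each block, so the first block has no descent and the second has
    those of [s]; a descent at the border [x] is allowed. *)
Lemma Des_join m s : count id m = x ->
  [forall i in Des (join_perm m s), (i : nat) \in J (x :: a)] =
  [forall i in Des s, (i : nat) \in J a].
Proof.
move=> cm; have /shuffleP sh : shuffle_of m \in shuffle x (x + n).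
  by have := shuffle_of_le m; rewrite cm.
apply/Des_subJP/Des_subJP => H i j ij nJ.
  have := H (rshift x i) (rshift x j); rewrite !pcompE !par_rshift /= => lt.
  apply: contraTT (lt _ _); rewrite -?leqNgt.
  - move=> ge; have ne : s i != s j.
      by rewrite (inj_eq perm_inj) -val_eqE /= -ij; lia.
    by apply/ltnW/sh; rewrite /= ?ltn_add2l ?leq_addr ?orbT // ltn_neqAle eq_sym ne.
  - by rewrite -ij addnS.
  - by rewrite mem_J_cons ?ltn_add2l // addKn (negbTE nJ) andbF orbF; lia.
have {nJ} := nJ; rewrite mem_J_cons ?ltn_ord // negb_or !pcompE => /andP[jx nJ].
have [jlt|jge] := ltnP j x.
  have E (k : 'I_(x + n)) (kx : (k < x)%N) : k = lshift n (Ordinal kx) by apply: val_inj.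
  have ix : (i < x)%N by apply: ltn_trans jlt; rewrite -ij.
  rewrite (E _ ix) (E _ jlt) !par_lshift !perm1; apply: sh; rewrite /= ?jlt //.
  by rewrite -ij.
have E (k : 'I_(x + n)) : (x <= k)%N -> exists k', k = rshift x k'.
  move=> kx; have lt : (k - x < n)%N by have := ltn_ord k; lia.
  by exists (Ordinal lt); apply: val_inj => /=; lia.
have [j' Ej] := E _ jge; have [|i' Ei] := E i.
  by move: jx; rewrite -ij; lia.
subst i j; rewrite !par_rshift; apply: sh; rewrite /= ?leq_addr ?orbT //.
rewrite ltn_add2l; apply: H; first by move: ij => /=; lia.
by move: nJ jx; rewrite /= addKn; case: (_ \in _); lia.
Qed.

(** With [y] the shuffle having the same values as [s] on the first block, [y^-1] after [s]
    preserves that block and increases on it, hence fixes it pointwise. *)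
Lemma join_perm_ex (s : 'S_(x + n)) :
  [forall i in Des s, (i : nat) \in J (x :: a)] ->
  exists t, join_perm (mask_of x s) t = s.
Proof.
move=> /Des_subJP H; set m := mask_of x s; pose y := shuffle_of m.
have cm : count id m = x by rewrite count_mask_of // leq_addr.
have /shuffleP sh : y \in shuffle x (x + n) by have := shuffle_of_le m; rewrite cm.
have sinc (i j : 'I_(x + n)) : (i < j)%N -> (j < x)%N -> (s i < s j)%N.
  case: j => j jn /=; elim: j jn => // j IH jn; rewrite ltnS => ij jx.
  have jn' := ltnW jn.
  have st : (s (Ordinal jn') < s (Ordinal jn))%N.
    by apply: H => //=; rewrite mem_J_cons //; lia.
  move: ij; rewrite leq_eqVlt => /orP[/eqP E|lt].
    by rewrite (_ : i = Ordinal jn') //; apply: val_inj.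
  by apply: ltn_trans st; apply: IH => //; apply: ltnW.
pose t := ((s * y^-1)%g : 'S_(x + n)).
have tE i : y (t i) = s i by rewrite permM permKV.
have tx i : (t i < x)%N = (i < x)%N.
  transitivity (tnth m (s i)); last by rewrite tnth_mktuple permK.
  by rewrite -(mask_shuffle_of m) cm tnth_mktuple -tE permK.
have tid : forall i : 'I_(x + n), (i < x)%N -> t i = i.
  apply: perm_increasing_id => // i j ij jx.
  have := sinc _ _ ij jx; rewrite -!tE; apply: contraTT; rewrite -!leqNgt.
  rewrite leq_eqVlt => /orP[/eqP/val_inj -> //|lt]; apply/ltnW/sh => //.
  by rewrite tx (ltn_trans ij jx).
have [s' Es'] : exists s', t = par (1%g : 'S_x) s'.
  by apply: par_fixed => i; apply: tid => /=.
by exists s'; apply/permP => i; rewrite pcompE -Es' tE.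
Qed.

End Step.

(** Identifies [X a] with the convolution of degree projections, one block at a time through the
    bijection [join_perm]. *)
Lemma sum_Des_unshuffles (A : eqType) (V : nmodType) (F : seq A -> V) a w :
  size w = sumn a ->
  \sum_(s : 'S_(sumn a) | [forall i in Des s, (i : nat) \in J a]) F (permw s w) =
  \sum_(v <- unshuffles a w) F v.
Proof.
elim: a F w => [|x a IH] F w sw.
  case: w sw => // _; rewrite big_seq1 (big_pred1 1%g) ?permw1 // => s.
  have -> : s = 1%g by apply/permP => -[].
  by transitivity true; [apply/forall_inP => -[]|rewrite /= eqxx].
pose h (ms : (x + sumn a).-tuple bool * 'S_(sumn a)) := join_perm ms.1 ms.2.
(* The default [1%g] is met only outside the descent class. *)
pose g (s : 'S_(x + sumn a)) :=
  (mask_of x s, odflt 1%g [pick t | join_perm (mask_of x s) t == s]).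
rewrite (reindex_onto h g) /= => [|s Ds]; last first.
  rewrite /h /g /=; case: pickP => [t /eqP //|].
  by have [t /eqP Et] := join_perm_ex Ds; move/(_ t); rewrite Et.
transitivity (\sum_(ms : (x + sumn a).-tuple bool * 'S_(sumn a) |
    (count id ms.1 == x) && [forall i in Des ms.2, (i : nat) \in J a]) F (permw (h ms) w)).
  apply: eq_bigl => -[m s]; rewrite /h /g /=.
  apply/andP/andP => [[D /eqP[Em _]]|[/eqP cm D]].
    have cm : count id m = x by rewrite -Em count_mask_of // leq_addr.
    by rewrite cm eqxx -(Des_join s cm).
  rewrite Des_join //; split=> //; rewrite mask_of_join //; apply/eqP; congr pair.
  case: pickP => [t /eqP/join_permI //|/(_ s)].
  by rewrite eqxx.
rewrite -(pair_big_dep (fun m : (x + sumn a).-tuple bool => count id m == x)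
  (fun _ s => [forall i in Des s, (i : nat) \in J a]) (fun m s => F (permw (h (m, s)) w))).
rewrite sum_unshuffles_cons big_mkcond [RHS]big_mkcond sum_splits_masks /=.
rewrite sw; apply: eq_bigr => m _; rewrite size_mask ?sw ?size_tuple //.
case: eqP => // cm.
have s2 : size (mask (map negb m) w) = sumn a.
  by rewrite size_mask ?size_map ?size_tuple ?sw // count_negb cm addKn.
rewrite -(IH (fun v => F (mask m w ++ v))) //; apply: eq_bigr => s _.
have s1 : size (mask m w) = x by rewrite size_mask ?size_tuple ?sw.
by rewrite /h permwM // permw_shuffle_of // permw_par // permw1.
Qed.

(** * From lists of rows to matrices *)

Lemma vec_splits_uniq c : uniq (vec_splits c).
Proof.
elim: c => // x c IH; apply: allpairs_uniq_dep; first exact: iota_uniq.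
  by move=> i _.
by move=> [i1 [r1 r2]] [i2 [s1 s2]] _ _ /= [-> -> _ ->].
Qed.

Lemma mem_vec_splits c (r1 r2 : seq nat) : size r1 = size c -> size r2 = size c ->
  (forall j, nth 0 r1 j + nth 0 r2 j = nth 0 c j)%N -> (r1, r2) \in vec_splits c.
Proof.
elim: c r1 r2 => [|x c IH] [|i r1] [|i' r2] //= [s1] [s2] H.
have /= x0 := H 0%N.
apply/(@allpairsPdep _ _ _ (fun i (r : seq nat * seq nat) => (i :: r.1, (x - i)%N :: r.2))
  (iota 0 x.+1) (fun=> vec_splits c)).
exists i, (r1, r2); split; first by rewrite mem_iota; lia.
  by apply: IH => // j; apply: (H j.+1).
by rewrite /= -x0 addKn.
Qed.

Lemma vec_splitsP c r : r \in vec_splits c -> size r.1 = size c /\ size r.2 = size c /\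
  (forall j, nth 0 r.1 j + nth 0 r.2 j = nth 0 c j)%N.
Proof.
elim: c r => [|x c IH] r; first by rewrite inE => /eqP ->; split=> //; split=> // -[].
move=> /allpairsPdep[i [q [+ /IH[s1 [s2 H]] ->]]] /=; rewrite mem_iota s1 s2 => lix.
by do 2!split=> //; case=> [|j] /=; [lia|apply: H].
Qed.

(** Needed to replace a sum over this list by one over a set. The sublists are disjoint because the
    first row [r.1] determines [r.2]. *)
Lemma row_splits_uniq b c : uniq (row_splits b c).
Proof.
elim: b c => [|y b IH] c /=; first by case: ifP.
have : uniq [seq r <- vec_splits c | sumn r.1 == y] by rewrite filter_uniq ?vec_splits_uniq.
have : all (mem (vec_splits c)) [seq r <- vec_splits c | sumn r.1 == y].
  by apply/allP => r; rewrite mem_filter => /andP[].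
elim: (filter _ _) => //= r s IHs /andP[rc sc] /andP[rs us].
rewrite cat_uniq IHs // andbT map_inj_uniq ?IH => [/=|? ? [] //].
apply/hasPn => N /flatten_mapP[t ts /mapP[M _ ->]]; apply/mapP => -[M' _ [E _]].
have tc : t \in vec_splits c := allP sc _ ts.
suff: r = t by move=> e; rewrite e ts in rs.
have [s1 [s2 H]] := vec_splitsP rc; have [s1' [s2' H']] := vec_splitsP tc.
rewrite [r]surjective_pairing [t]surjective_pairing E; congr pair.
apply: (@eq_from_nth _ 0%N) => [|j _]; first by rewrite s2.
by have := H j; rewrite -H' E => /addnI.
Qed.

(** The lengths must be prescribed, since [nth] with default 0 cannot see trailing zeros. *)
Lemma row_splitsP b c M : reflect
  [/\ map sumn M = b, all (fun r => size r == size c) M &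
      forall j, \sum_(r <- M) nth 0%N r j = nth 0%N c j]
  (M \in row_splits b c).
Proof.
apply: (iffP idP); elim: b c M => [|y b IH] c M /=.
- case: eqP => // c0; rewrite inE => /eqP ->; split=> // j; rewrite big_nil.
  by elim: c c0 j => [|[|x] c IHc] //= c0 [|j] //=; apply: IHc.
- case/flatten_mapP => r; rewrite mem_filter => /andP[/eqP <- /vec_splitsP[s1 [s2 H]]].
  case/mapP => N /IH[<- al E] ->; split=> //=; first by rewrite s1 eqxx -s2.
  by move=> j; rewrite big_cons E -H.
- case: M => [|r M] [] //= _ _ H; rewrite ifT //; apply/eqP.
  elim: c H => //= x c IHc H; have := H 0%N; rewrite big_nil /= => <-.
  by apply: IHc => j; have := H j.+1; rewrite !big_nil.
- case: M => [[]//|r M] /= [E /andP[/eqP rs al] H]; case: E => sr sM.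
  (* What the first row leaves of [c]: the column sums of the other rows. *)
  pose r' := mkseq (fun j => \sum_(s <- M) nth 0%N s j)%N (size c).
  have r'E j : nth 0%N r' j = (\sum_(s <- M) nth 0%N s j)%N.
    have [lt|ge] := ltnP j (size c); first by rewrite nth_mkseq.
    rewrite nth_default ?size_mkseq // big_seq big1 // => s sM'.
    by rewrite nth_default // (eqP (allP al _ sM')).
  apply/flatten_mapP; exists (r, r').
    rewrite mem_filter sr eqxx mem_vec_splits ?size_mkseq // => j.
    by rewrite r'E -H big_cons.
  apply/mapP; exists M => //; apply: IH; split=> //.
  by apply: sub_all al => s; rewrite size_mkseq.
Qed.

Definition rows_of n r c (M : 'M['I_n.+1]_(r, c)) : seq (seq nat) :=
  [seq [seq (M i j : nat) | j <- enum 'I_c] | i <- enum 'I_r].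

Lemma reading_rows n r c (M : 'M['I_n.+1]_(r, c)) :
  reading M = [seq x <- flatten (rows_of M) | x != 0%N].
Proof. by []. Qed.

Lemma sumn_enum n (F : 'I_n -> nat) : sumn [seq F i | i <- enum 'I_n] = (\sum_i F i)%N.
Proof. by rewrite sumnE big_map big_enum. Qed.

Lemma nth_enum_map n (T : Type) (x : T) (F : 'I_n -> T) (i : 'I_n) :
  nth x [seq F i | i <- enum 'I_n] i = F i.
Proof. by rewrite (nth_map i) ?size_enum_ord // nth_ord_enum. Qed.

Lemma rows_of_inj n r c : injective (@rows_of n r c).
Proof.
move=> M N E; apply/matrixP => i j; apply: val_inj.
have := congr1 (fun R => nth 0%N (nth [::] R i) j) E.
by rewrite !nth_enum_map.
Qed.

Section RowsOf.
Variables (n : nat) (b c : seq nat).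

Definition margins (M : 'M['I_n.+1]_(size b, size c)) : bool :=
  [forall j, \sum_i (M i j : nat) == nth 0 c j]%N &&
  [forall i, \sum_j (M i j : nat) == nth 0 b i]%N.

Lemma rows_of_splits M : (rows_of M \in row_splits b c) = margins M.
Proof.
have sz (i : 'I_(size b)) : nth [::] (rows_of M) i = [seq (M i j : nat) | j <- enum 'I_(size c)].
  by rewrite nth_enum_map.
have szR : size (rows_of M) = size b by rewrite size_map size_enum_ord.
have colE (j : 'I_(size c)) : (\sum_(r <- rows_of M) nth 0 r j = \sum_i M i j)%N.
  rewrite big_map big_enum; apply: eq_bigr => i _.
  by rewrite (nth_enum_map 0%N (fun j => M i j : nat)).
apply/row_splitsP/andP => [[rs _ cs]|[/forallP cs /forallP rs]].
  split; apply/forallP => i; first by rewrite -cs colE.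
  by rewrite -[X in _ == nth _ X _]rs (nth_map [::]) ?szR // sz sumn_enum.
split.
- apply: (@eq_from_nth _ 0%N) => [|i]; rewrite size_map szR // => lt.
  rewrite (nth_map [::]) ?szR //.
  by rewrite -[i]/(val (Ordinal lt)) sz sumn_enum; apply/eqP.
- by apply/allP => r /mapP[i _ ->]; rewrite size_map size_enum_ord.
- move=> j; have [lt|ge] := ltnP j (size c).
    by rewrite -[j]/(val (Ordinal lt)) colE; apply/eqP.
  rewrite [RHS]nth_default // big_map big1 // => i _.
  by rewrite nth_default // size_map size_enum_ord.
Qed.

Lemma rows_of_surj R : all (fun x => x <= n)%N b -> R \in row_splits b c ->
  exists M : 'M['I_n.+1]_(size b, size c), rows_of M = R.
Proof.
move=> /allP bn /row_splitsP[rs /allP sr _].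
have sR : size R = size b by rewrite -rs size_map.
(* [inord] is exact: an entry is at most its row sum, hence at most [n]. *)
exists (\matrix_(i, j) inord (nth 0%N (nth [::] R i) j)).
apply: (@eq_from_nth _ [::]); first by rewrite size_map size_enum_ord sR.
rewrite size_map size_enum_ord => i lt; rewrite -[i]/(val (Ordinal lt)) nth_enum_map.
have iR : (i < size R)%N by rewrite sR.
have /eqP si := sr _ (mem_nth [::] iR).
apply: (@eq_from_nth _ 0%N); first by rewrite size_map size_enum_ord si.
rewrite size_map size_enum_ord => j ltj; rewrite -[j]/(val (Ordinal ltj)).
rewrite (nth_map (Ordinal ltj)) ?size_enum_ord // nth_ord_enum mxE inordK //= ltnS.
apply: (@leq_trans (nth 0%N b i)); last exact/bn/mem_nth.
rewrite -rs (nth_map [::]) // sumnE (big_nth 0%N) si big_mkord.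
by rewrite (bigD1 (Ordinal ltj)) //= leq_addr.
Qed.

Lemma sum_row_splits (V : nmodType) (P : pred (seq (seq nat))) (F : seq (seq nat) -> V) :
  all (fun x => x <= n)%N b ->
  \sum_(R <- row_splits b c | P R) F R =
  \sum_(M | margins M && P (rows_of M)) F (rows_of M).
Proof.
move=> bn.
rewrite [RHS](big_mkcondr _ _ margins) -[RHS]big_filter [LHS]big_mkcond.
rewrite -[RHS](big_map (@rows_of n _ _) predT (fun R => if P R then F R else 0)).
apply: perm_big; apply: uniq_perm; first exact: row_splits_uniq.
  by rewrite (map_inj_uniq (@rows_of_inj _ _ _)) filter_uniq ?index_enum_uniq.
move=> R; apply/idP/mapP => [RI|[M]].
  have [M E] := rows_of_surj bn RI; exists M; rewrite ?E //.
  by rewrite mem_filter mem_index_enum -rows_of_splits E RI.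
by rewrite mem_filter -rows_of_splits => /andP[RI _] ->.
Qed.

End RowsOf.

(** * Evaluation on tensor algebras *)

Section Tensor.
Context (k : fieldType) (d : nat).
Notation word := (word d).
Notation T := {malg k[word]}.

Lemma comul_word (w : word) :
  comul << w >> = \sum_(p <- splits w) << (p : word * word) >> :> {malg k[(word * word)%type]}.
Proof. by rewrite (sum_splits_masks (fun p => << (p : word * word) >>)) /comul linextU. Qed.

Lemma comul_sum I (r : seq I) (F : I -> T) :
  comul (\sum_(i <- r) F i) = \sum_(i <- r) comul (F i).
Proof. by rewrite /comul linear_sum. Qed.

(** On words of length [sumn a] this is [sum_Des_unshuffles]; on the others both sides vanish. *)
Lemma Psi_X a (w : word) :
  Psi (X k a) << w >> = \sum_(v <- unshuffles a w) << (v : word) >> :> T.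
Proof.
rewrite Psi_word /X linear_sum /=.
have [sw|nw] := eqVneq (size w) (sumn a); last first.
  rewrite unshuffles_neq // big_nil big1 // => s _.
  by rewrite linextU /Defs.act /= (negbTE nw).
rewrite -(sum_Des_unshuffles (fun v => << (v : word) >>) sw).
by apply: eq_bigr => s _; rewrite linextU /Defs.act /= sw eqxx.
Qed.

Lemma heis_End_X a b (w : word) :
  heis_End (Psi (X k a)) (Psi (X k b)) << w >> =
  \sum_(p <- splits w) \sum_(u <- unshuffles a p.1) \sum_(q <- splits u)
     \sum_(v <- unshuffles b (p.2 ++ q.1)) << (q.2 ++ v : word) >> :> T.
Proof.
rewrite /heis_End comul_word linear_sum /=; apply: eq_bigr => p _.
rewrite linextU Psi_X comul_sum linear_sum /=; apply: eq_bigr => u _.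
rewrite comul_word linear_sum /=; apply: eq_bigr => q _.
rewrite linextU concUU Psi_X /conc linextU linear_sum /=; apply: eq_bigr => v _.
by rewrite linextU.
Qed.

End Tensor.

Theorem theorem7p4 (k : fieldType) (char0 : [pchar k] =i pred0)
  (p q : nat) (a b : seq nat)
  (Ha : is_composition p a) (Hb : is_composition q b) :
  heis (X k a) (X k b) =
  \sum_(maxn p q <= n < (p + q).+1)
    \sum_(M in matrices n a b) X k (reading M).
Proof.
have [Ep Eq] : sumn a = p /\ sumn b = q.
  by case/andP: Ha => _ /eqP ->; case/andP: Hb => _ /eqP ->.
apply: Psi_inj => d h; apply: eq_linext => w; rewrite -!Psi_word.
rewrite heis_Psi heis_End_X (sum_unshuffles_heis_mx (fun v => << (v : word d) >>)).
rewrite Ep Eq Psi_word linear_sum /=; set m := size w.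
pose G n := \sum_(M <- row_splits ((n - q)%N :: b) ((n - p)%N :: a) |
  head 0%N (flatten M) == 0%N) \sum_(v <- unshuffles (flatten M) w) << (v : word d) >>.
transitivity (\sum_(maxn p q <= n < (p + q).+1) if n == m then G k n else 0).
  rewrite -big_mkcond big_nat1_eq; case: ifP => //.
apply: eq_big_nat => n rg.
transitivity (G k n).
  (* The entries of [M] sum to [n], so a word of another length has no cutting along them. *)
  case: eqP => // nm; rewrite /G big_seq_cond big1 // => M /andP[/row_splits_sumn[EM _] _].
  rewrite unshuffles_neq ?big_nil // EM /= Eq subnK; last by lia.
  by rewrite eq_sym; apply/eqP.
(* The row sums, [n - q] and the parts of [b], are at most [n]. *)
rewrite /G (@sum_row_splits n); last first.
  rewrite /= leq_subr; apply/allP => x xb.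
  have : (x <= sumn b)%N by rewrite sumnE (big_rem x) //= leq_addr.
  by lia.
rewrite linear_sum /=; apply: eq_big => M; last first.
  move=> _; rewrite -Psi_word Psi_X reading_rows.
  by rewrite (sum_unshuffles_filter (fun v => << (v : word d) >>)).
rewrite inE /margins Ep Eq andbC; congr (_ && _).
(* Both uses of [enum_ordSl] expose the corner entry as the head of the flattened rows. *)
by rewrite /rows_of enum_ordSl /= enum_ordSl.
Qed.
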